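(* Let $P$ be the marginal Metropolis--Hastings kernel with target $\pi$, proposal $q$ and rejection probability $\rho$, and let $\bar P$ be the auxiliary kernel on $\mathsf X\times\mathsf W$ $$\bar P(x,w;\mathrm dy,\mathrm du)=q(x,\mathrm dy)\pi_y(\mathrm du)\min\{1,r(x,y)\}+\delta_{x,w}(\mathrm dy,\mathrm du)\rho(x).$$ The spectral gap of $\bar P$ satisfies $$\operatorname{Gap}(P)\wedge\Bigl(1-\operatorname*{ess\,sup}_{x\in\mathsf X}\rho(x)\Bigr)\le\operatorname{Gap}(\bar P)\le\operatorname{Gap}(P),$$ where the essential supremum is with respect to $\pi$.
   Context: Let $(\mathsf X,\mathcal B(\mathsf X))$ be a measurable space, $\pi$ a probability measure on it and $q(x,\mathrm dy)$ a Markov kernel on $\mathsf X$. The function $r(x,y)=\frac{\pi(\mathrm dy)q(y,\mathrm dx)}{\pi(\mathrm dx)q(x,\mathrm dy)}$ is the Radon--Nikodym derivative in the sense of Tierney: there is a symmetric measurable set $R\subset\mathsf X^2$ on which the measures $\pi(\mathrm dx)q(x,\mathrm dy)$ and $\pi(\mathrm dy)q(y,\mathrm dx)$ are mutually absolutely continuous, and on whose complement they are mutually singular; on $R$, $r$ is the density of the second with respect to the first, with values in $(0,\infty)$ and $r(x,y)r(y,x)=1$; off $R$, $r:=0$. The marginal kernel is $P(x,\mathrm dy)=\min\{1,r(x,y)\}q(x,\mathrm dy)+\delta_x(\mathrm dy)\rho(x)$ with $\rho(x)=1-\int\min\{1,r(x,y)\}q(x,\mathrm dy)$; it is reversible with respect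 to $\pi$. Let $\mathsf W$ be a Borel subset of $\mathbb R_+=[0,\infty)$ and let $x\mapsto Q_x$ be a probability kernel from $\mathsf X$ to $\mathsf W$ with $\int w\,Q_x(\mathrm dw)=1$ for all $x$. Put $\pi_x(\mathrm dw)=w\,Q_x(\mathrm dw)$ and $\tilde\pi(\mathrm dx,\mathrm dw)=\pi(\mathrm dx)\pi_x(\mathrm dw)$; $\bar P$ is reversible with respect to $\tilde\pi$. For a Markov kernel $\Pi$ reversible with respect to a probability $\mu$ and $g$ with $\mu(g^2)<\infty$, the Dirichlet form is $\mathcal E_\Pi(g)=\langle g,(I-\Pi)g\rangle_\mu=\frac12\int\mu(\mathrm dx)\Pi(x,\mathrm dy)[g(x)-g(y)]^2$, where $\langle f,g\rangle_\mu=\int fg\,\mathrm d\mu$, and the (right) spectral gap is $\operatorname{Gap}(\Pi)=\inf\{\mathcal E_\Pi(g)/\operatorname{var}_\mu(g):\operatorname{var}_\mu(g)>0\}=\inf\{\mathcal E_\Pi(g):\mu(g)=0,\ \mu(g^2)=1\}$, with $\operatorname{var}_\mu(g)=\mu((g-\mu(g))^2)$. $a\wedge b=\min\{a,b\}$. *)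

(* Defs.v *)
From HB Require Import structures.
From mathcomp Require Import all_boot all_order all_algebra.
From mathcomp Require Import all_classical all_reals all_analysis.
From mathcomp Require Import measurable_realfun ess_sup_inf.
Set Implicit Arguments.
Unset Strict Implicit.
Unset Printing Implicit Defensive.
Import Order.TTheory GRing.Theory Num.Theory.
Import numFieldNormedType.Exports.
Local Open Scope classical_set_scope.
Local Open Scope ring_scope.
Local Open Scope ereal_scope.

(** [joint_law mu k] is the measure [mu(dx) k(x, dy)] on the product space. *)
Section joint_law.
Context d1 d2 (X : measurableType d1) (Y : measurableType d2) (R : realType).
Variables (mu : {measure set X -> \bar R}) (k : R.-pker X ~> Y).

Definition joint_law (A : set (X * Y)) : \bar R :=
  \int[mu]_x k x (xsection A x).

Let joint_law0 : joint_law set0 = 0.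
Proof. by apply: integral0_eq => x _; rewrite xsection0 measure0. Qed.

Let joint_law_ge0 A : 0 <= joint_law A.
Proof. exact: integral_ge0. Qed.

Let joint_law_sigma_additive : semi_sigma_additive joint_law.
Proof.
move=> F mF tF mUF.
rewrite [X in _ --> X](_ : _ = \sum_(n <oo) joint_law (F n)).
  by apply/cvg_closeP; split; [exact: is_cvg_nneseries|rewrite closeE].
rewrite -integral_nneseries//; last first.
  by move=> n; apply: measurable_fun_xsection_finite_kernel; rewrite inE.
apply: eq_integral => x _; apply/esym/cvg_lim => //=; rewrite xsection_bigcup.
apply: (measure_sigma_additive _ (trivIset_xsection tF)) => ?.
exact: measurable_xsection.
Qed.

HB.instance Definition _ := isMeasure.Build _ _ _ joint_law
  joint_law0 joint_law_ge0 joint_law_sigma_additive.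

Lemma joint_lawT : joint_law setT = mu setT.
Proof.
rewrite /joint_law (eq_integral (cst 1)); first by rewrite integral_cst// mul1e.
by move=> x _; rewrite xsectionE preimage_setT prob_kernel.
Qed.

End joint_law.

Section joint_law_probability.
Context d1 d2 (X : measurableType d1) (Y : measurableType d2) (R : realType).
Variables (mu : probability X R) (k : R.-pker X ~> Y).

Let joint_law1 : joint_law mu k setT = 1.
Proof. by rewrite joint_lawT; exact: probability_setT. Qed.

HB.instance Definition _ :=
  Measure_isProbability.Build _ _ _ (joint_law mu k) joint_law1.

End joint_law_probability.

Section spectral_gap.
Context d (T : measurableType d) (R : realType).
Variables (mu : probability T R) (K : R.-pker T ~> T).

Definition inner_prod (f g : T -> R) : R := (\int[mu]_x (f x * g x))%R.

Definition kernel_op (g : T -> R) : T -> R := fun x => (\int[K x]_y g y)%R.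

Definition dirichlet (g : T -> R) : R := inner_prod g (g \- kernel_op g)%R.

(** The infimum is taken in [\bar R], so that it is [+oo] when every
    square-integrable function is [mu]-a.e. constant. *)
Definition spectral_gap : \bar R :=
  ereal_inf [set (dirichlet g / fine 'V_mu[g])%:E |
             g in [set g : T -> R | g \in Lfun mu 2%:E /\ 0 < 'V_mu[g]]].

End spectral_gap.

Section mh_ratio.
Context d (X : measurableType d) (R : realType).
Variables (pi : probability X R) (q : R.-pker X ~> X).

(** [joint_law pi q] is [pi(dx) q(x, dy)]; the next set function is
    [pi(dy) q(y, dx)], its image under the exchange of coordinates. *)
Definition rev_joint_law : set (X * X) -> \bar R :=
  pushforward (joint_law pi q) (fun z : X * X => (z.2, z.1)).

(** [r] is the Radon--Nikodym derivative of [pi(dy) q(y, dx)] with respect to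
    [pi(dx) q(x, dy)] in the sense of Tierney, with equivalence set [S]. *)
Record is_mh_ratio (S : set (X * X)) (r : X -> X -> R) : Prop := IsMHRatio {
  mh_set_measurable : measurable S ;
  mh_set_sym : forall x y, S (x, y) -> S (y, x) ;
  mh_set_equiv : forall A, measurable A -> A `<=` S ->
    (joint_law pi q A = 0 <-> rev_joint_law A = 0) ;
  mh_set_singular : exists2 N : set (X * X), measurable N &
    joint_law pi q (~` S `&` N) = 0 /\ rev_joint_law (~` S `\` N) = 0 ;
  mh_ratio_measurable :
    measurable_fun [set: X * X] (fun z : X * X => r z.1 z.2) ;
  mh_ratio_density : forall A, measurable A -> A `<=` S ->
    rev_joint_law A = \int[joint_law pi q]_(z in A) (r z.1 z.2)%:E ;
  mh_ratio_gt0 : forall x y, S (x, y) -> (0 < r x y)%R ;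
  mh_ratio_inv : forall x y, S (x, y) -> (r x y * r y x = 1)%R ;
  mh_ratio_out : forall x y, ~ S (x, y) -> r x y = 0%R }.

Lemma mh_ratio_ge0 S r : is_mh_ratio S r -> forall x y, (0 <= r x y)%R.
Proof.
move=> hr x y; have [Sxy|nSxy] := pselect (S (x, y)).
  exact/ltW/(mh_ratio_gt0 hr).
by rewrite (mh_ratio_out hr).
Qed.

End mh_ratio.

Section rejection.
Context d (X : measurableType d) (R : realType).
Variables (q : R.-pker X ~> X) (r : X -> X -> R).

Definition accept_prob (x y : X) : R := Num.min 1%R (r x y).

Definition rejection (x : X) : R := (1 - \int[q x]_y accept_prob x y)%R.

End rejection.

Section density_kernel.
Context d1 d2 (X : measurableType d1) (Y : measurableType d2) (R : realType).
Variables (k : R.-fker X ~> Y) (f : X -> Y -> R).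

Definition density (x : X) (A : set Y) : \bar R :=
  \int[k x]_(y in A) (f x y)%:E.

Hypothesis f0 : forall x y, (0 <= f x y)%R.
Hypothesis mf : measurable_fun [set: X * Y] (fun z => f z.1 z.2).

Let mf2 x : measurable_fun [set: Y] (EFin \o f x).
Proof.
apply/measurable_EFinP.
exact: (measurable_fun_pair2 (f := fun z => f z.1 z.2) x mf).
Qed.

Let density0 x : density x set0 = 0.
Proof. exact: integral_set0. Qed.

Let density_ge0 x A : 0 <= density x A.
Proof. by apply: integral_ge0 => y _; rewrite lee_fin. Qed.

Let density_sigma_additive x : semi_sigma_additive (density x).
Proof.
move=> F mF tF mUF; rewrite /density ge0_integral_bigcup//; last 2 first.
- exact/measurable_funTS/mf2.
- by move=> y _; rewrite lee_fin.
by apply: is_cvg_nneseries => n _ _; exact: density_ge0.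
Qed.

HB.instance Definition _ x := isMeasure.Build _ _ _ (density x)
  (density0 x) (@density_ge0 x) (@density_sigma_additive x).

Definition density_kernel : X -> {measure set Y -> \bar R} :=
  fun x => density x.

Let density_measurable U : measurable U ->
  measurable_fun [set: X] (density_kernel ^~ U).
Proof.
move=> mU; pose h (z : X * Y) := ((f z.1 z.2)%:E * (\1_U z.2)%:E).
have -> : density_kernel ^~ U = (fun x => \int[k x]_y h (x, y)).
  apply/funext => x; rewrite /density_kernel/= /density integral_mkcond.
  apply: eq_integral => y _; rewrite patchE /h/= indicE.
  by case: ifPn => _; rewrite ?mule1 ?mule0.
apply: measurable_fun_integral_finite_kernel.
  by move=> z; rewrite /h mule_ge0// lee_fin.
apply: emeasurable_funM; first exact/measurable_EFinP.
exact/measurable_EFinP/measurableT_comp.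
Qed.

HB.instance Definition _ := isKernel.Build _ _ _ _ _
  density_kernel density_measurable.

End density_kernel.

Section holding_kernel.
Context d (Z : measurableType d) (R : realType).
Variables (K : R.-ker Z ~> Z) (rho : Z -> R).

(** [K(z, dz') + rho(z) delta_z(dz')]; the hypothesis on total masses is only
    an argument so that the Markov kernel structure can be inferred. *)
Definition holding_kernel (rho_ge0 : forall z, (0 <= rho z)%R)
    (_ : forall z, K z [set: Z] + (rho z)%:E = 1) (z : Z) :
    {measure set Z -> \bar R} :=
  measure_add (K z) (mscale (NngNum (rho_ge0 z)) \d_z).

Hypothesis rho_ge0 : forall z, (0 <= rho z)%R.
Hypothesis Krho1 : forall z, K z [set: Z] + (rho z)%:E = 1.

Lemma holding_kernelE z A :
  holding_kernel rho_ge0 Krho1 z A = K z A + (rho z)%:E * \d_z A.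
Proof. by rewrite /holding_kernel/= -/(measure_add (K z) _) measure_addE. Qed.

Let measurable_rho : measurable_fun [set: Z] rho.
Proof.
have -> : rho = (fun z => 1 - fine (K z setT))%R.
  apply/funext => z; have := Krho1 z.
  have := measure_ge0 (K z) setT.
  case: (K z setT) => [a| |]//= _ /eqP.
  by rewrite -EFinD eqe => /eqP <-; rewrite addrAC subrr add0r.
apply: measurable_funB => //; apply: measurableT_comp => //.
exact: measurable_kernel.
Qed.

Let holding_measurable U : measurable U ->
  measurable_fun [set: Z] (holding_kernel rho_ge0 Krho1 ^~ U).
Proof.
move=> mU; under eq_fun do rewrite holding_kernelE.
apply: emeasurable_funD; first exact: measurable_kernel.
apply: emeasurable_funM; first exact/measurable_EFinP.
exact/measurable_EFinP/measurable_indic.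
Qed.

HB.instance Definition _ := isKernel.Build _ _ _ _ _
  (holding_kernel rho_ge0 Krho1) holding_measurable.

Let holdingT z : holding_kernel rho_ge0 Krho1 z [set: Z] = 1.
Proof. by rewrite holding_kernelE diracT mule1 Krho1. Qed.

HB.instance Definition _ := Kernel_isProbability.Build _ _ _ _ _
  (holding_kernel rho_ge0 Krho1) holdingT.

End holding_kernel.

Section marginal_kernel.
Context d (X : measurableType d) (R : realType).
Variables (pi : probability X R) (q : R.-pker X ~> X).
Variables (S : set (X * X)) (r : X -> X -> R).
Hypothesis hr : is_mh_ratio pi q S r.

Lemma accept_prob_ge0 x y : (0 <= accept_prob r x y)%R.
Proof. by rewrite /accept_prob le_min ler01 (mh_ratio_ge0 hr). Qed.

Lemma measurable_accept_prob :
  measurable_fun [set: X * X] (fun z => accept_prob r z.1 z.2).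
Proof. exact: measurable_minr (mh_ratio_measurable hr). Qed.

(** [min{1, r(x, y)} q(x, dy)] *)
Definition accepted : R.-ker X ~> X :=
  density_kernel q accept_prob_ge0 measurable_accept_prob.

Let acceptedTE x : accepted x [set: X] = \int[q x]_y (accept_prob r x y)%:E.
Proof. by []. Qed.

Let accepted_le1 x : accepted x [set: X] <= 1.
Proof.
rewrite acceptedTE; apply: (@le_trans _ _ (\int[q x]_y (cst 1 y))); last first.
  by rewrite integral_cst// mul1e prob_kernel.
apply: ge0_le_integral => //.
- by move=> y _; rewrite lee_fin accept_prob_ge0.
- apply/measurable_EFinP; exact: (measurable_fun_pair2
    (f := fun z => accept_prob r z.1 z.2) x measurable_accept_prob).
- by move=> y _; rewrite lee_fin /accept_prob ge_min lexx.
Qed.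

Lemma rejectionE x : accepted x [set: X] + (rejection q r x)%:E = 1.
Proof.
rewrite /rejection /Rintegral -acceptedTE.
have fx : accepted x [set: X] \is a fin_num.
  by rewrite ge0_fin_numE// (le_lt_trans (accepted_le1 x))// ltry.
by rewrite -[X in X + _](fineK fx) -EFinD addrC subrK.
Qed.

Lemma rejection_ge0 x : (0 <= rejection q r x)%R.
Proof.
rewrite /rejection subr_ge0 -lee_fin /Rintegral -acceptedTE fineK//.
by rewrite ge0_fin_numE// (le_lt_trans (accepted_le1 x))// ltry.
Qed.

(** [P(x, dy) = min{1, r(x, y)} q(x, dy) + rho(x) delta_x(dy)] *)
Definition marginal_kernel : R.-pker X ~> X :=
  holding_kernel rejection_ge0 rejectionE.

Lemma marginal_kernelE x A : marginal_kernel x A =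
  \int[q x]_(y in A) (accept_prob r x y)%:E + (rejection q r x)%:E * \d_x A.
Proof. exact: holding_kernelE. Qed.

End marginal_kernel.

(** A measurable type is inhabited, whence the last field; it is no restriction
    for a space carrying a probability measure. *)
Record borel_weights (R : realType) := BorelWeights {
  weight_set : set R ;
  weight_set_measurable : measurable weight_set ;
  weight_set_ge0 : weight_set `<=` [set w | (0 <= w)%R] ;
  weight_set_neq0 : weight_set !=set0 }.

Definition weight (R : realType) (W : borel_weights R) : Type :=
  {w : R | w \in weight_set W}.

Section weight.
Context (R : realType) (W : borel_weights R).

Definition weight_val (w : weight W) : R := sval w.

Let weight_point : weight W.
Proof.
have w := cid (weight_set_neq0 W).
by exists (sval w); rewrite inE; exact: svalP.
Qed.

HB.instance Definition _ := Choice.on (weight W).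
HB.instance Definition _ := isPointed.Build (weight W) weight_point.

HB.instance Definition _ :=
  Measurable.copy (weight W) (g_sigma_algebra_preimageType weight_val).

Lemma weight_val_ge0 (w : weight W) : (0 <= weight_val w)%R.
Proof. by apply: (@weight_set_ge0 _ W); have := svalP w; rewrite inE. Qed.

Lemma measurable_weight_val : measurable_fun [set: weight W] weight_val.
Proof. by move=> _ A mA; rewrite setTI; exists A => //; rewrite setTI. Qed.

End weight.

Section weighted_kernel.
Context d (X : measurableType d) (R : realType) (W : borel_weights R).
Variable Q : R.-pker X ~> weight W.
Hypothesis hQ : forall x, \int[Q x]_w (weight_val w)%:E = 1.

Let weight_val2_ge0 (x : X) (w : weight W) : (0 <= weight_val w)%R.
Proof. exact: weight_val_ge0. Qed.

Let measurable_weight_val2 :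
  measurable_fun [set: X * weight W] (fun z => weight_val z.2).
Proof. exact: (measurableT_comp (@measurable_weight_val R W)). Qed.

(** [pi_x(dw) = w Q_x(dw)] *)
Definition weighted_kernel of (forall x, \int[Q x]_w (weight_val w)%:E = 1) :
    X -> {measure set (weight W) -> \bar R} :=
  density_kernel Q weight_val2_ge0 measurable_weight_val2.

HB.instance Definition _ := Kernel.on (weighted_kernel hQ).

Let weighted_kernelT x : weighted_kernel hQ x [set: weight W] = 1.
Proof. exact: hQ. Qed.

HB.instance Definition _ := Kernel_isProbability.Build _ _ _ _ _
  (weighted_kernel hQ) weighted_kernelT.

End weighted_kernel.

Section auxiliary_kernel.
Context d (X : measurableType d) (R : realType) (W : borel_weights R).
Variables (pi : probability X R) (q : R.-pker X ~> X).
Variables (S : set (X * X)) (r : X -> X -> R).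
Hypothesis hr : is_mh_ratio pi q S r.
Variable Q : R.-pker X ~> weight W.
Hypothesis hQ : forall x, \int[Q x]_w (weight_val w)%:E = 1.

(** [pi(dx) pi_x(dw)] *)
Definition aux_target : probability (X * weight W)%type R :=
  joint_law pi (weighted_kernel hQ).

(** [q(x, dy) pi_y(du) min{1, r(x, y)}] *)
Definition aux_accepted (z : X * weight W) :
    {measure set (X * weight W) -> \bar R} :=
  joint_law (accepted hr z.1) (weighted_kernel hQ).

Let aux_accepted_measurable U : measurable U ->
  measurable_fun [set: X * weight W] (aux_accepted ^~ U).
Proof.
move=> mU.
apply: (measurableT_comp (f := fun x => \int[accepted hr x]_y
   weighted_kernel hQ y (xsection U y))) => //.
apply: measurable_fun_integral_kernel => //.
  by move=> V mV; exact: measurable_kernel.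
by apply: measurable_fun_xsection_finite_kernel; rewrite inE.
Qed.

HB.instance Definition _ :=
  isKernel.Build _ _ _ _ _ aux_accepted aux_accepted_measurable.

Let aux_rejection_ge0 (z : X * weight W) : (0 <= rejection q r z.1)%R.
Proof. exact: rejection_ge0 hr _. Qed.

Let aux_rejectionE (z : X * weight W) :
  aux_accepted z [set: X * weight W] + (rejection q r z.1)%:E = 1.
Proof.
rewrite (_ : aux_accepted z _ = accepted hr z.1 [set: X]) ?rejectionE//.
exact: joint_lawT.
Qed.

(** [q(x, dy) pi_y(du) min{1, r(x, y)} + delta_{x, w}(dy, du) rho(x)] *)
Definition auxiliary_kernel : R.-pker (X * weight W) ~> (X * weight W)%type :=
  holding_kernel aux_rejection_ge0 aux_rejectionE.

Lemma auxiliary_kernelE z A : auxiliary_kernel z A =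
  \int[accepted hr z.1]_y weighted_kernel hQ y (xsection A y) +
  (rejection q r z.1)%:E * \d_z A.
Proof. exact: holding_kernelE. Qed.

End auxiliary_kernel.

(* Main.v *)
Require Import Defs.
From HB Require Import structures.
From mathcomp Require Import all_boot all_order all_algebra.
From mathcomp Require Import all_classical all_reals all_analysis.
From mathcomp Require Import measurable_realfun ess_sup_inf.
From mathcomp Require Import ring lra.

(** The auxiliary chain draws the new weight afresh from the fibre law whenever
    a proposal is accepted, so its off-diagonal part sees a function
    [f(x, w)] only through its fibre means [f0(x) = \int pi_x(dw) f(x, w)].

    If [f] depends on [x] alone, the auxiliary chain acts on it as the marginal
    chain does, with the same Dirichlet form and the same variance; testing the
    infimum on such functions bounds the auxiliary gap by the marginal gap
    ([spectral_gap_lifted_le]).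

    For a general square-integrable [f], let [v(x)] be the variance of
    [f(x, .)] under the fibre law. Conditioning on [x] gives
    [Var f = Var f0 + \int v dpi] ([variance_lifted]). Since for almost every
    [(x, w)]
    [(P' f)(x, w) = (P f0)(x) + rho(x) (f(x, w) - f0(x))]
    ([kernel_op_lifted]), the Dirichlet forms satisfy
    [E'(f) = E(f0) + \int (1 - rho) v dpi] ([dirichlet_lifted]). If [lam] is at
    most the marginal gap and at most [1 - ess sup rho], then the first summand
    is at least [lam Var f0], and the second at least [lam \int v dpi], because
    [v] is nonnegative. Adding up gives the lower bound
    ([dirichlet_lifted_ge], [spectral_gap_lifted_ge]).

    Both bounds hold for any chain that either moves by a kernel [A] or holds
    with probability [rho(x)], lifted to a product space by refreshing the
    second coordinate at each move, as soon as
    [\int pi(dx) P(x, B) <= C pi(B)]: this bound makes [P] well defined and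
    bounded on square-integrable functions up to null sets. For the
    Metropolis--Hastings kernel it holds with [C = 2], because
    [min(1, r) <= r] and [r] is a density of the reversed proposal law
    ([accepted_subinvariant]). *)

Set Implicit Arguments.
Unset Strict Implicit.
Unset Printing Implicit Defensive.
Import Order.TTheory GRing.Theory Num.Theory.
Import numFieldNormedType.Exports.
Local Open Scope classical_set_scope.
Local Open Scope ring_scope.
Local Open Scope ereal_scope.

(** * Integration preliminaries *)

Section integration.
Context d (T : measurableType d) (R : realType).
Variable mu : {measure set T -> \bar R}.
Implicit Types f g : T -> R.

Lemma ae_eq_Rintegral f g :
  measurable_fun [set: T] f -> measurable_fun [set: T] g ->
  (\forall x \ae mu, f x = g x) -> (\int[mu]_x f x = \int[mu]_x g x)%R.
Proof.
move=> mf mg fg; congr fine; apply: ae_eq_integral => //.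
- exact/measurable_EFinP.
- exact/measurable_EFinP.
- by apply: filterS fg => x fgx _; rewrite fgx.
Qed.

Lemma ae_ge0_Rintegral f : measurable_fun [set: T] f ->
  (\forall x \ae mu, (0 <= f x)%R) -> (0 <= \int[mu]_x f x)%R.
Proof.
move=> mf f0; rewrite (@ae_eq_Rintegral f (fun x => `|f x|%R))//.
- by apply: Rintegral_ge0 => x _; exact: normr_ge0.
- exact: measurableT_comp.
- by apply: filterS f0 => x fx0; rewrite ger0_norm.
Qed.

Lemma Lfun2P f : f \in Lfun mu 2%:E <->
  measurable_fun [set: T] f /\ \int[mu]_x (f x ^+ 2)%:E < +oo.
Proof.
split=> [f2|[mf f2]].
  split; first by move: f2; rewrite inE => /andP[]; rewrite inE.
  by have := Lfun2_integrable_sqr f2; move/integrable_lty => /=; exact.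
rewrite inE/=; apply/andP; split; rewrite inE//=.
rewrite /finite_norm unlock poweR_lty//.
by under eq_integral do rewrite /= powR_mulrn// real_normK ?num_real//.
Qed.

Lemma integrable_sqrP f : measurable_fun [set: T] f ->
  f \in Lfun mu 2%:E <-> mu.-integrable [set: T] (fun x => (f x ^+ 2)%:E).
Proof.
move=> mf; split; first exact: Lfun2_integrable_sqr.
by move=> /integrable_lty f2; apply/Lfun2P; split => //; exact: f2.
Qed.

End integration.

Section image_measure.
Context d1 d2 (T1 : measurableType d1) (T2 : measurableType d2) (R : realType).
Variables (m1 : {measure set T1 -> \bar R}) (m2 : {measure set T2 -> \bar R}).
Variable phi : T1 -> T2.
Hypothesis mphi : measurable_fun [set: T1] phi.
Hypothesis m12 : forall A, measurable A -> m1 (phi @^-1` A) = m2 A.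

(** The identity holds separately for the positive and negative parts of [g],
    so both sides agree even where the integral only has its conventional
    value. Kernel operators can therefore be compared at every point. *)
Lemma integral_image (g : T2 -> \bar R) : measurable_fun [set: T2] g ->
  \int[m1]_x g (phi x) = \int[m2]_y g y.
Proof.
have ge0_image (h : T2 -> \bar R) : (forall y, 0 <= h y) ->
    measurable_fun [set: T2] h -> \int[m1]_x h (phi x) = \int[m2]_y h y.
  move=> h0 mh; transitivity (\int[pushforward m1 phi]_y h y).
    by rewrite ge0_integral_pushforward.
  by apply: eq_measure_integral => A mA _; exact: m12.
move=> mg; rewrite integralE [RHS]integralE.
congr (_ - _).
  rewrite -(ge0_image g^\+)//; last exact: measurable_funepos.
  apply: eq_integral => x _.
  by rewrite -[in RHS]/((g^\+ \o phi) x) -funepos_comp.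
rewrite -(ge0_image g^\-)//; last exact: measurable_funeneg.
apply: eq_integral => x _.
by rewrite -[in RHS]/((g^\- \o phi) x) -funeneg_comp.
Qed.

Lemma Rintegral_image (g : T2 -> R) : measurable_fun [set: T2] g ->
  (\int[m1]_x g (phi x) = \int[m2]_y g y)%R.
Proof.
move=> mg; congr fine; apply: (integral_image (g := EFin \o g)).
exact/measurable_EFinP.
Qed.

End image_measure.

(** * Fubini's theorem for joint laws *)

Section joint_law_integral.
Context d1 d2 (X : measurableType d1) (Y : measurableType d2) (R : realType).
Variables (mu : {measure set X -> \bar R}) (k : R.-pker X ~> Y).

Import HBNNSimple.

Let integral_joint_law_nnsfun (f : {nnsfun (X * Y)%type >-> R}) :
  \int[joint_law mu k]_z (f z)%:E = \int[mu]_x \int[k x]_y (f (x, y))%:E.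
Proof.
under [in LHS]eq_integral do rewrite fimfunE -fsumEFin//.
rewrite ge0_integral_fsum//; last 2 first.
- by move=> r; exact/measurable_EFinP/measurableT_comp.
- by move=> r z _; rewrite EFinM nnfun_muleindic_ge0.
have mf r : measurable (f @^-1` [set r]) by [].
have msec r :
    measurable_fun [set: X] (fun x => k x (xsection (f @^-1` [set r]) x)).
  by apply: measurable_fun_xsection_finite_kernel; rewrite inE.
under [RHS]eq_integral => x _.
  rewrite (eq_integral (fun y => \sum_(r \in range f)
      (r * \1_(xsection (f @^-1` [set r]) x) y)%R%:E)); last first.
    move=> y _; rewrite fimfunE -fsumEFin//; apply: eq_fsbigr => r _.
    by rewrite !indicE mem_xsection.
  rewrite ge0_integral_fsum//; last 2 first.
  - move=> r; apply/measurable_EFinP/measurable_funM => //.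
    exact/measurable_indic/measurable_xsection.
  - move=> r y _; rewrite EFinM.
    have := nnfun_muleindic_ge0 f r (x, y).
    by rewrite !indicE mem_xsection.
  under eq_fsbigr => r _.
    rewrite (integralZl_indic _ (fun r => xsection (f @^-1` [set r]) x))//;
      last 2 first.
    - by move=> r0; rewrite preimage_nnfun0// xsection0.
    - exact: measurable_xsection.
    rewrite integral_indic ?setIT//; last exact: measurable_xsection.
    over.
  over.
rewrite ge0_integral_fsum//; last 2 first.
- by move=> r; exact: measurable_funeM.
- move=> r x _; have [r0|r0] := leP 0%R r; first by rewrite mule_ge0.
  by rewrite preimage_nnfun0// xsection0 measure0 mule0.
apply: eq_fsbigr => r _.
rewrite (integralZl_indic _ (fun r => f @^-1` [set r]))//; last first.
  exact: preimage_nnfun0.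
rewrite integral_indic// setIT.
have [r0|r0] := leP 0%R r; first by rewrite ge0_integralZl.
rewrite preimage_nnfun0// measure0 mule0 integral0_eq// => x _.
by rewrite xsection0 measure0 mule0.
Qed.

(** Tonelli's theorem: the formula is the definition of the joint law on
    indicators, and passes to simple functions by linearity and to their
    increasing limits by monotone convergence. *)
Lemma ge0_integral_joint_law (f : X * Y -> \bar R) : (forall z, 0 <= f z) ->
  measurable_fun [set: X * Y] f ->
  \int[joint_law mu k]_z f z = \int[mu]_x \int[k x]_y f (x, y).
Proof.
move=> f0 mf; pose f_ := nnsfun_approx measurableT mf.
have f_cvg z : (f_ n z)%:E @[n --> \oo] --> f z by exact: cvg_nnsfun_approx.
have nd_f z : nondecreasing_seq (fun n => (f_ n z)%:E).
  by move=> a b ab; rewrite lee_fin; exact/lefP/nd_nnsfun_approx.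
transitivity (limn (fun n => \int[joint_law mu k]_z (f_ n z)%:E)).
  rewrite -monotone_convergence//.
  - by apply: eq_integral => z _; apply/esym/cvg_lim.
  - by move=> n; exact/measurable_EFinP.
  - by move=> n z _; rewrite lee_fin.
under eq_fun do rewrite integral_joint_law_nnsfun.
have msec n x : measurable_fun [set: Y] (fun y => (f_ n (x, y))%:E).
  by apply/measurable_EFinP; exact: (measurable_fun_pair2 x).
rewrite -monotone_convergence//; last 3 first.
- move=> n; apply: (@measurable_fun_integral_finite_kernel _ _ _ _ _
    (fun z => (f_ n z)%:E)) => //; first by move=> z; rewrite lee_fin.
  exact/measurable_EFinP.
- by move=> n x _; apply: integral_ge0 => y _; rewrite lee_fin.
- move=> x _ a b ab; apply: ge0_le_integral => //.
  + by move=> y _; rewrite lee_fin.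
  + by move=> y _; exact: nd_f.
apply: eq_integral => x _; rewrite -monotone_convergence//.
- by apply: eq_integral => y _; apply/cvg_lim.
- by move=> n y _; rewrite lee_fin.
Qed.

End joint_law_integral.

Section disintegration.
Context d1 d2 (X : measurableType d1) (Y : measurableType d2) (R : realType).
Variables (mu : {measure set X -> \bar R}) (k : R.-pker X ~> Y).
Local Notation J := (joint_law mu k).
Implicit Types (h f : X * Y -> R) (u : X -> R).

(** A version of the conditional expectation of [h] given the first
    coordinate, under the joint law of any [mu] with [k]; it takes the
    conventional value of the integral where [h (x, .)] is not integrable. *)
Definition cond_mean h (x : X) : R := (\int[k x]_y h (x, y))%R.

Lemma measurable_cond_mean h : measurable_fun [set: X * Y] h ->
  measurable_fun [set: X] (cond_mean h).
Proof.
move=> mh; have mEh : measurable_fun [set: X * Y] (EFin \o h).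
  exact/measurable_EFinP.
have -> : cond_mean h = fine \o (fun x =>
    \int[k x]_y (EFin \o h)^\+ (x, y) - \int[k x]_y (EFin \o h)^\- (x, y)).
  apply/funext => x; rewrite /cond_mean /Rintegral/= integralE.
  congr (fine (_ - _)); apply: eq_integral => y _.
    by rewrite -[RHS]/(((EFin \o h)^\+ \o pair x) y) -funepos_comp.
  by rewrite -[RHS]/(((EFin \o h)^\- \o pair x) y) -funeneg_comp.
apply: measurableT_comp => //; apply: emeasurable_funB.
  apply: measurable_fun_integral_finite_kernel => //.
  exact: measurable_funepos.
apply: measurable_fun_integral_finite_kernel => //.
exact: measurable_funeneg.
Qed.

Lemma le_norm_cond_mean h x : measurable_fun [set: X * Y] h ->
  `|cond_mean h x|%:E <= \int[k x]_y `|h (x, y)|%:E.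
Proof.
move=> mh; apply: (@le_trans _ _ `|\int[k x]_y (h (x, y))%:E|).
  rewrite /cond_mean /Rintegral; case: (\int[k x]_y _) => [r| |]//=.
    by rewrite leey.
  by rewrite leey.
apply: (le_abse_integral (k x) measurableT (f := EFin \o (h \o pair x))).
by apply/measurable_EFinP; exact: (measurable_fun_pair2 x).
Qed.

Section integrable.
Variable h : X * Y -> R.
Hypothesis ih : J.-integrable [set: X * Y] (EFin \o h).

Let mh : measurable_fun [set: X * Y] h.
Proof. by apply/measurable_EFinP; case/integrableP : ih. Qed.

Let mnormh : measurable_fun [set: X * Y] (fun z => `|h z|%:E).
Proof. by apply/measurable_EFinP; exact: measurableT_comp. Qed.

Let integrable_norm :
  mu.-integrable [set: X] (fun x => \int[k x]_y `|h (x, y)|%:E).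
Proof.
apply/integrableP; split.
  exact: (@measurable_fun_integral_finite_kernel _ _ _ _ _
    (fun z => `|h z|%:E)).
case/integrableP : ih => _; rewrite (@ge0_integral_joint_law _ _ _ _ _ _ _
  (fun z => `|h z|%:E))//; apply: le_lt_trans.
rewrite le_eqVlt; apply/orP; left; apply/eqP; apply: eq_integral => x _.
by rewrite gee0_abs// integral_ge0.
Qed.

Lemma integrable_joint_law_ae :
  \forall x \ae mu, (k x).-integrable [set: Y] (fun y => (h (x, y))%:E).
Proof.
apply: filterS (integrable_ae measurableT integrable_norm) => x /(_ I) fin.
apply/integrableP; split.
  by apply/measurable_EFinP; exact: (measurable_fun_pair2 x).
by rewrite -ge0_fin_numE// integral_ge0.
Qed.

Lemma integrable_cond_mean : mu.-integrable [set: X] (EFin \o cond_mean h).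
Proof.
apply: le_integrable integrable_norm => //.
  exact/measurable_EFinP/measurable_cond_mean.
move=> x _ /=; rewrite [leRHS]gee0_abs ?integral_ge0//.
exact: le_norm_cond_mean.
Qed.

Lemma integral_cond_mean : \int[J]_z (h z)%:E = \int[mu]_x (cond_mean h x)%:E.
Proof.
have mEh : measurable_fun [set: X * Y] (EFin \o h) by exact/measurable_EFinP.
pose p x := \int[k x]_y (EFin \o h)^\+ (x, y).
pose n x := \int[k x]_y (EFin \o h)^\- (x, y).
have mp : measurable_fun [set: X] p.
  exact/measurable_fun_integral_finite_kernel/measurable_funepos.
have mn : measurable_fun [set: X] n.
  exact/measurable_fun_integral_finite_kernel/measurable_funeneg.
have Jp : \int[J]_z (EFin \o h)^\+ z = \int[mu]_x p x.
  by rewrite ge0_integral_joint_law//; exact: measurable_funepos.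
have Jn : \int[J]_z (EFin \o h)^\- z = \int[mu]_x n x.
  by rewrite ge0_integral_joint_law//; exact: measurable_funeneg.
have ip : mu.-integrable [set: X] p.
  apply/integrableP; split => //.
  under eq_integral do rewrite gee0_abs ?integral_ge0//.
  by rewrite -/p -Jp; exact: integral_funepos_lt_pinfty.
have iN : mu.-integrable [set: X] n.
  apply/integrableP; split => //.
  under eq_integral do rewrite gee0_abs ?integral_ge0//.
  by rewrite -/n -Jn; exact: integral_funeneg_lt_pinfty.
rewrite (_ : \int[J]_z (h z)%:E = \int[mu]_x p x - \int[mu]_x n x); last first.
  by rewrite [LHS]integralE -Jp -Jn.
rewrite -integralB//.
apply: ae_eq_integral => //.
- exact: emeasurable_funB.
- exact/measurable_EFinP/measurable_cond_mean.
apply: filterS integrable_joint_law_ae => x ihx _.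
rewrite /cond_mean /Rintegral fineK; last exact: integrable_fin_num.
rewrite [RHS]integralE/=; congr (_ - _); apply: eq_integral => y _.
  by rewrite -[LHS]/(((EFin \o h)^\+ \o pair x) y) -funepos_comp.
by rewrite -[LHS]/(((EFin \o h)^\- \o pair x) y) -funeneg_comp.
Qed.

Lemma Rintegral_cond_mean : (\int[J]_z h z = \int[mu]_x cond_mean h x)%R.
Proof. by rewrite /Rintegral integral_cond_mean. Qed.

End integrable.

(** What is known about the first coordinate comes out of the conditional
    mean. *)
Lemma Rintegral_joint_lawM u h : measurable_fun [set: X] u ->
  J.-integrable [set: X * Y] (EFin \o h) ->
  J.-integrable [set: X * Y] (fun z => (u z.1 * h z)%:E) ->
  (\int[J]_z (u z.1 * h z) = \int[mu]_x (u x * cond_mean h x))%R.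
Proof.
move=> m_u ih iuh.
have mh : measurable_fun [set: X * Y] h.
  by apply/measurable_EFinP; case/integrableP : ih.
have muh : measurable_fun [set: X * Y] (fun z => u z.1 * h z)%R.
  by apply/measurable_EFinP; case/integrableP : iuh.
rewrite (Rintegral_cond_mean iuh); apply: ae_eq_Rintegral.
- exact: measurable_cond_mean.
- by apply: measurable_funM => //; exact: measurable_cond_mean.
apply: filterS (integrable_joint_law_ae ih) => x ihx.
by rewrite /cond_mean/= RintegralZl.
Qed.

Lemma joint_law_fst A : measurable A -> J (fst @^-1` A) = mu A.
Proof.
move=> mA; transitivity (\int[mu]_x (\1_A x)%:E).
  apply: eq_integral => x _; rewrite -setXT indicE.
  have [xA|xA] := boolP (x \in A).
    by rewrite in_xsectionX// prob_kernel.
  by rewrite notin_xsectionX// measure0.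
by rewrite integral_indic// setIT.
Qed.

Lemma ae_joint_law_fst (P : X -> Prop) :
  (\forall x \ae mu, P x) -> \forall z \ae J, P z.1.
Proof.
move=> [N [mN N0 PN]]; exists (fst @^-1` N); split.
- by rewrite -[X in measurable X]setTI; exact: measurable_fst.
- by rewrite joint_law_fst.
- by move=> z; exact: PN.
Qed.

End disintegration.

(** * Conditional means of square-integrable functions *)

Section kernel_at.
Context d1 d2 (X : measurableType d1) (Y : measurableType d2) (R : realType).
Variables (k : R.-pker X ~> Y) (x : X).

(** The law [k x] as a probability, so that a variance under it makes sense. *)
Definition kernel_at : set Y -> \bar R := k x.

HB.instance Definition _ := Measure.on kernel_at.

Let kernel_at1 : kernel_at [set: Y] = 1.
Proof. exact: prob_kernel. Qed.

HB.instance Definition _ :=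
  Measure_isProbability.Build _ _ _ kernel_at kernel_at1.

End kernel_at.

Section square_integrable.
Context d1 d2 (X : measurableType d1) (Y : measurableType d2) (R : realType).
Variables (mu : {measure set X -> \bar R}) (k : R.-pker X ~> Y).
Local Notation J := (joint_law mu k).

Lemma ge0_integral_joint_law_fst (u : X -> \bar R) : (forall x, 0 <= u x) ->
  measurable_fun [set: X] u -> \int[J]_z u z.1 = \int[mu]_x u x.
Proof.
move=> u0 m_u; rewrite (ge0_integral_joint_law _ _ (f := fun z => u z.1))//.
  apply: eq_integral => x _; rewrite -[LHS]/(\int[k x]_y cst (u x) y).
  by rewrite integral_cst// prob_kernel mule1.
exact: measurableT_comp.
Qed.

Lemma Lfun2_fst (u : X -> R) : u \in Lfun mu 2%:E -> u \o fst \in Lfun J 2%:E.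
Proof.
move=> /Lfun2P[m_u u2]; apply/Lfun2P; split; first exact: measurableT_comp.
rewrite (ge0_integral_joint_law_fst (u := fun x => (u x ^+ 2)%:E))//.
  by move=> x; rewrite lee_fin sqr_ge0.
exact/measurable_EFinP/measurable_funX.
Qed.

(** The difference of the two sides is the variance of [h (x, .)] under
    [k x]. *)
Lemma sqr_cond_mean_le (h : X * Y -> R) : h \in Lfun J 2%:E ->
  \forall x \ae mu,
    (cond_mean k h x ^+ 2 <= cond_mean k (fun z => h z ^+ 2) x)%R.
Proof.
move=> h2; have [mh _] := (Lfun2P _ _).1 h2.
have := integrable_joint_law_ae (Lfun2_integrable_sqr h2).
apply: filterS => x ihx.
pose kx : probability Y R := kernel_at k x.
have hx2 : (fun y => h (x, y)) \in Lfun kx 2%:E.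
  apply/integrable_sqrP; [exact: (measurable_fun_pair2 x)|exact: ihx].
have kxh : (fun y => h (x, y)) \in Lfun kx 1.
  by apply: (Lfun_subset12 _ hx2); exact: fin_num_measure.
have := variance_ge0 kx (fun y => h (x, y)).
rewrite varianceE// unlock.
rewrite -[X in X - _]fineK; last exact: (integrable_fin_num measurableT ihx).
rewrite -[X in _ - X ^+ _]fineK; last first.
  by apply: integrable_fin_num => //; exact/Lfun1_integrable.
by rewrite -EFin_expe -EFinB lee_fin subr_ge0.
Qed.

Lemma Lfun2_cond_mean (h : X * Y -> R) : h \in Lfun J 2%:E ->
  cond_mean k h \in Lfun mu 2%:E.
Proof.
move=> h2; have [mh _] := (Lfun2P _ _).1 h2.
have ih2 := Lfun2_integrable_sqr h2.
apply/Lfun2P; split; first exact: measurable_cond_mean.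
apply: le_lt_trans (integrable_lty measurableT (integrable_cond_mean ih2)).
have mh2 : measurable_fun [set: X * Y] (fun z => h z ^+ 2)%R.
  exact: measurable_funX.
apply: ae_ge0_le_integral => //.
- by move=> x _; rewrite lee_fin sqr_ge0.
- exact/measurable_EFinP/measurable_funX/measurable_cond_mean.
- by move=> x _; rewrite lee_fin; apply: Rintegral_ge0 => y _; rewrite sqr_ge0.
- exact/measurable_EFinP/measurable_cond_mean.
- by apply: filterS (sqr_cond_mean_le h2) => x + _; rewrite lee_fin.
Qed.

End square_integrable.

(** * Quasi-invariant kernels *)

(** A null set for [mu] must stay null after one step of [P], and
    square-integrability must be preserved; a bound on [mu P] by a multiple of
    [mu] is enough for both. *)
Section quasi_invariance.
Context d (X : measurableType d) (R : realType).
Variables (mu : {measure set X -> \bar R}) (P : R.-pker X ~> X).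
Variable C : {nonneg R}.
Hypothesis muP : forall B, measurable B -> \int[mu]_x P x B <= C%:num%:E * mu B.

Lemma ge0_integral_quasi_invariant (g : X -> \bar R) : (forall x, 0 <= g x) ->
  measurable_fun [set: X] g ->
  \int[mu]_x \int[P x]_y g y <= C%:num%:E * \int[mu]_x g x.
Proof.
move=> g0 mg; rewrite -ge0_integral_mscale//.
rewrite -(ge0_integral_joint_law mu P (f := fun z => g z.2))//; last first.
  exact: measurableT_comp.
rewrite (@integral_image _ _ _ _ _ _ (pushforward (joint_law mu P) snd) snd)//.
apply: ge0_le_measure_integral => // B mB.
rewrite /pushforward/= /joint_law /mscale/=; apply: le_trans (muP mB).
rewrite le_eqVlt; apply/orP; left; apply/eqP/eq_integral => x _.
by rewrite xsection_preimage_snd.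
Qed.

(** [P g] is the conditional mean, under [mu(dx) P(x, dy)], of the function [g]
    of the second coordinate. *)
Lemma Lfun2_kernel_op (g : X -> R) : g \in Lfun mu 2%:E ->
  kernel_op P g \in Lfun mu 2%:E.
Proof.
move=> /Lfun2P[mg g2].
have mg2 : measurable_fun [set: X] (fun x => (g x ^+ 2)%:E).
  exact/measurable_EFinP/measurable_funX.
apply: (@Lfun2_cond_mean _ _ _ _ _ mu P (g \o snd)).
apply/Lfun2P; split; first exact: measurableT_comp.
rewrite (ge0_integral_joint_law mu P (f := fun z => (g z.2 ^+ 2)%:E));
  last 2 first.
- by move=> z; rewrite lee_fin sqr_ge0.
- exact: (measurableT_comp mg2).
apply: le_lt_trans (ge0_integral_quasi_invariant _ mg2) _.
  by move=> x; rewrite lee_fin sqr_ge0.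
by rewrite lte_mul_pinfty// lee_fin.
Qed.

(** The mean of [|g - c|] after one step vanishes by quasi-invariance, so for
    almost every [x] the function [g] equals [c] almost surely under [P x]. *)
Lemma kernel_op_ae_cst (g : X -> R) c : measurable_fun [set: X] g ->
  (\forall x \ae mu, g x = c) -> \forall x \ae mu, kernel_op P g x = c.
Proof.
move=> mg gc; pose e x := `|g x - c|%:E.
have me : measurable_fun [set: X] e.
  by apply/measurable_EFinP/measurableT_comp => //; exact: measurable_funB.
have e0 x : 0 <= e x by rewrite lee_fin.
have ie0 : \int[mu]_x e x = 0.
  transitivity (\int[mu]_x (cst 0 x)); last exact: integral0.
  apply: ae_eq_integral => //; apply: filterS gc => x gxc _.
  by rewrite /e gxc subrr normr0.
have mPe : measurable_fun [set: X] (fun x => \int[P x]_y e y).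
  by apply: measurable_fun_integral_kernel => // U; exact: measurable_kernel.
have iPe0 : \int[mu]_x `|\int[P x]_y e y| = 0.
  under eq_integral do rewrite gee0_abs ?integral_ge0//.
  apply/eqP; rewrite eq_le integral_ge0 ?andbT; last first.
    by move=> x _; exact: integral_ge0.
  by rewrite (le_trans (ge0_integral_quasi_invariant e0 me))// ie0 mule0.
have := (ae_eq_integral_abs mu measurableT mPe).1 iPe0.
apply: filterS => x /(_ I) Pe0.
rewrite /kernel_op (@ae_eq_Rintegral _ _ _ (P x) g (cst c))//.
  by rewrite Rintegral_cst// prob_kernel mulr1.
have : \int[P x]_y `|e y| = 0.
  by rewrite -[RHS]Pe0; apply: eq_integral => y _; rewrite gee0_abs.
move/(ae_eq_integral_abs (P x) measurableT me).1; apply: filterS => y /(_ I).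
by move=> [] /eqP; rewrite normr_eq0 subr_eq0 => /eqP.
Qed.

End quasi_invariance.

Lemma measurable_kernel_op d (Z : measurableType d) (R : realType)
    (K : R.-pker Z ~> Z) (g : Z -> R) : measurable_fun [set: Z] g ->
  measurable_fun [set: Z] (kernel_op K g).
Proof.
move=> mg; apply: (@measurable_cond_mean _ _ _ _ _ K (g \o snd)).
exact: measurableT_comp.
Qed.

(** * Kernels with a holding probability *)

Section integral_holding_kernel.
Context d (Z : measurableType d) (R : realType).
Variables (K : R.-ker Z ~> Z) (rho : Z -> R).
Hypothesis rho_ge0 : forall z, (0 <= rho z)%R.
Hypothesis Krho1 : forall z, K z [set: Z] + (rho z)%:E = 1.
Local Notation P := (holding_kernel rho_ge0 Krho1).

Lemma holding_prob_le1 z : (rho z <= 1)%R.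
Proof. by rewrite -lee_fin -(Krho1 z) leeDr. Qed.

Lemma measurable_holding_prob : measurable_fun [set: Z] rho.
Proof.
have -> : rho = (fun z => 1 - fine (K z setT))%R.
  apply/funext => z; have := Krho1 z; have := measure_ge0 (K z) setT.
  case: (K z setT) => [a| |]//= _ /eqP.
  by rewrite -EFinD eqe => /eqP <-; rewrite addrAC subrr add0r.
apply: measurable_funB => //; apply: measurableT_comp => //.
exact: measurable_kernel.
Qed.

Lemma ge0_integral_holding (g : Z -> \bar R) z : (forall y, 0 <= g y) ->
  measurable_fun [set: Z] g ->
  \int[P z]_y g y = \int[K z]_y g y + (rho z)%:E * g z.
Proof.
move=> g0 mg; rewrite ge0_integral_measure_add//; congr (_ + _).
by rewrite ge0_integral_mscale//= integral_dirac// diracT mul1e.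
Qed.

Lemma kernel_op_holding (g : Z -> R) z :
  (K z).-integrable [set: Z] (EFin \o g) ->
  kernel_op P g z = (\int[K z]_y g y + rho z * g z)%R.
Proof.
move=> ig.
have mg : measurable_fun [set: Z] (EFin \o g) by case/integrableP : ig.
have [a pE] : exists a, \int[K z]_y (EFin \o g)^\+ y = a%:E.
  exists (fine (\int[K z]_y (EFin \o g)^\+ y)).
  by rewrite fineK// integrable_pos_fin_num.
have [b nE] : exists b, \int[K z]_y (EFin \o g)^\- y = b%:E.
  exists (fine (\int[K z]_y (EFin \o g)^\- y)).
  by rewrite fineK// integrable_neg_fin_num.
have -> : (\int[K z]_y g y = a - b)%R.
  by rewrite /Rintegral [X in fine X]integralE pE nE.
rewrite /kernel_op /Rintegral integralE.
rewrite !ge0_integral_holding//;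
  [|exact: measurable_funeneg|exact: measurable_funepos].
rewrite pE nE funeposE funenegE/= -!EFin_max -!EFinM -!EFinD/=.
have gz : g z = (Num.max (g z) 0 - Num.max (- g z) 0)%R.
  by case: (lerP 0%R (g z)) => gz; rewrite /Num.max; case: ifP; lra.
rewrite [in RHS]gz; ring.
Qed.

End integral_holding_kernel.

(** * Chains lifted to a product space *)

(** The lift [P'] moves the first coordinate as [P] does; at each move it draws
    the second one from [k], and a rejected move leaves both unchanged. *)
Section lifted_chain.
Context d1 d2 (X : measurableType d1) (Y : measurableType d2) (R : realType).
Variables (pi : probability X R) (k : R.-pker X ~> Y).
Variables (A : R.-ker X ~> X) (rho : X -> R).
Hypothesis rho_ge0 : forall x, (0 <= rho x)%R.
Hypothesis Arho1 : forall x, A x [set: X] + (rho x)%:E = 1.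
Variable A' : R.-ker (X * Y) ~> (X * Y)%type.
Hypothesis rho'_ge0 : forall z : X * Y, (0 <= rho z.1)%R.
Hypothesis A'rho1 : forall z, A' z [set: X * Y] + (rho z.1)%:E = 1.
Hypothesis A'E : forall z U, measurable U -> A' z U = joint_law (A z.1) k U.

Local Notation P := (holding_kernel rho_ge0 Arho1).
Local Notation P' := (holding_kernel rho'_ge0 A'rho1).
Local Notation J := (joint_law pi k).

(** The first coordinate of the lifted chain is the original chain. *)
Lemma kernel_op_fst (g : X -> R) z : measurable_fun [set: X] g ->
  kernel_op P' (g \o fst) z = kernel_op P g z.1.
Proof.
move=> mg; apply: (Rintegral_image (phi := @fst X Y)) => // B mB.
have mfB : measurable (@fst X Y @^-1` B).
  by rewrite -[X in measurable X]setTI; exact: measurable_fst.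
rewrite /= !holding_kernelE//; congr (_ + _).
by apply: etrans (A'E _ mfB) _; rewrite joint_law_fst.
Qed.

(** Functions of the first coordinate are admissible test functions for the
    lifted chain and have the same Rayleigh quotient as for the original one. *)
Lemma spectral_gap_lifted_le : spectral_gap J P' <= spectral_gap pi P.
Proof.
apply: ereal_inf_le_tmp => _ [g [g2 Vg] <-]; have [mg _] := (Lfun2P _ _).1 g2.
have E_fst (u : X -> R) : measurable_fun [set: X] u ->
    \int[J]_z (u z.1)%:E = \int[pi]_x (u x)%:E.
  move=> mu; apply: (@integral_image _ _ _ _ _ J pi fst _ _ (EFin \o u)) => //.
    by move=> B mB; exact: joint_law_fst.
  exact/measurable_EFinP.
have V_fst : 'V_J[g \o fst] = 'V_pi[g].
  have -> : 'V_J[g \o fst] = 'E_J[(g \o fst \- cst (fine 'E_pi[g]))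
      * (g \o fst \- cst (fine 'E_pi[g]))].
    rewrite /variance covariance.unlock (_ : 'E_J[g \o fst] = 'E_pi[g])//.
    by rewrite unlock E_fst.
  rewrite /variance covariance.unlock; set m := fine _.
  rewrite unlock; apply: (E_fst ((g \- cst m) * (g \- cst m))%R).
  by apply: measurable_funM; exact: measurable_funB.
exists (g \o fst); first by split; [exact: Lfun2_fst|rewrite V_fst].
rewrite V_fst; congr (_ / _)%:E; rewrite /dirichlet /inner_prod /Rintegral.
congr fine; rewrite -(E_fst (fun x => g x * _)%R).
  by apply: eq_integral => z _; rewrite /= kernel_op_fst.
apply: measurable_funM => //; apply: measurable_funB => //.
exact: measurable_kernel_op.
Qed.

Section lower_bound.
Variable C : {nonneg R}.
Hypothesis piP : forall B, measurable B -> \int[pi]_x P x B <= C%:num%:E * pi B.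

Let mrho : measurable_fun [set: X] rho := measurable_holding_prob Arho1.

(** A move averages [f] over the fibre it lands in, so [P' f] and [P f0] differ
    only in the holding term. The identity needs [f] to be integrable after a
    move from [x]; quasi-invariance gives this for almost every [x]. *)
Lemma kernel_op_lifted (f : X * Y -> R) :
  J.-integrable [set: X * Y] (EFin \o f) ->
  \forall z \ae J, kernel_op P' f z =
    (kernel_op P (cond_mean k f) z.1 + rho z.1 * (f z - cond_mean k f z.1))%R.
Proof.
move=> intf; have mf : measurable_fun [set: X * Y] f.
  by apply/measurable_EFinP; case/integrableP : intf.
have mnf : measurable_fun [set: X * Y] (fun z => `|f z|%:E).
  by apply/measurable_EFinP; exact: measurableT_comp.
(* The fibre means of [|f|] are integrable under [pi], hence under [P x] for
   almost every [x]. *)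
pose h x := \int[k x]_y `|f (x, y)|%:E.
have h0 x : 0 <= h x by exact: integral_ge0.
have mh : measurable_fun [set: X] h.
  exact: (@measurable_fun_integral_finite_kernel _ _ _ _ _
    (fun z => `|f z|%:E)).
have intPh : pi.-integrable [set: X] (fun x => \int[P x]_y h y).
  apply/integrableP; split.
    by apply: measurable_fun_integral_kernel => // U; exact: measurable_kernel.
  under eq_integral do rewrite gee0_abs ?integral_ge0//.
  apply: le_lt_trans (ge0_integral_quasi_invariant piP h0 mh) _.
  rewrite lte_mul_pinfty ?lee_fin// -(ge0_integral_joint_law _ _
    (f := fun z => `|f z|%:E))//.
  by case/integrableP : intf.
have intAf : \forall x \ae pi,
    (joint_law (A x) k).-integrable [set: X * Y] (EFin \o f).
  apply: filterS (integrable_ae measurableT intPh) => x /(_ I) Ph_fin.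
  apply/integrableP; split; first exact/measurable_EFinP.
  rewrite (ge0_integral_joint_law _ _ (f := fun z => `|f z|%:E))//.
  apply: (@le_lt_trans _ _ (\int[P x]_y h y)).
    by rewrite ge0_integral_holding// leeDl// mule_ge0// lee_fin.
  by rewrite -ge0_fin_numE// integral_ge0.
apply: filterS (ae_joint_law_fst k intAf) => z intAfz.
have A'_eq (g : X * Y -> \bar R) :
    \int[A' z]_t g t = \int[joint_law (A z.1) k]_t g t.
  by apply: eq_measure_integral => U mU _; exact: A'E.
rewrite kernel_op_holding; last first.
  apply/integrableP; split; first exact/measurable_EFinP.
  by rewrite A'_eq; case/integrableP : intAfz.
rewrite kernel_op_holding; last exact: integrable_cond_mean.
rewrite -(Rintegral_cond_mean intAfz) {1}/Rintegral A'_eq -/(Rintegral _ _ _).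
by ring.
Qed.

Section dirichlet_form.
Variable f : X * Y -> R.
Hypothesis f2 : f \in Lfun J 2%:E.
Local Notation f0 := (cond_mean k f).
Local Notation m2 := (cond_mean k (fun z => f z ^+ 2)%R).
Local Notation v := (fun x => m2 x - f0 x ^+ 2)%R.

Let mf : measurable_fun [set: X * Y] f := ((Lfun2P _ _).1 f2).1.

Let f0_2 : f0 \in Lfun pi 2%:E := Lfun2_cond_mean f2.

Let mf0 : measurable_fun [set: X] f0 := measurable_cond_mean k mf.

Let intf2 : J.-integrable [set: X * Y] (EFin \o (fun z => f z ^+ 2)%R).
Proof. exact: Lfun2_integrable_sqr. Qed.

Let intf : J.-integrable [set: X * Y] (EFin \o f).
Proof.
apply/Lfun1_integrable; apply: (Lfun_subset12 _ f2).
exact: fin_num_measure.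
Qed.

Let intm2 : pi.-integrable [set: X] (EFin \o m2).
Proof. exact: (integrable_cond_mean intf2). Qed.

Let intf0_2 : pi.-integrable [set: X] (EFin \o (fun x => f0 x ^+ 2)%R).
Proof. exact: Lfun2_integrable_sqr. Qed.

(** Law of total variance: [v] is the variance of [f] along the fibres. *)
Lemma variance_lifted : (fine 'V_J[f] = fine 'V_pi[f0] + \int[pi]_x v x)%R.
Proof.
have Ef : 'E_J[f] = 'E_pi[f0] by rewrite unlock; exact: integral_cond_mean.
rewrite !varianceE// Ef.
have -> : 'E_J[f ^+ 2] = (\int[pi]_x m2 x)%:E.
  rewrite unlock -(Rintegral_cond_mean intf2) fineK//.
  exact: (integrable_fin_num measurableT intf2).
have -> : 'E_pi[f0 ^+ 2] = (\int[pi]_x f0 x ^+ 2)%:E.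
  by rewrite unlock fineK//; exact: (integrable_fin_num measurableT intf0_2).
have -> : 'E_pi[f0] = (fine 'E_pi[f0])%:E.
  rewrite fineK// unlock; apply: integrable_fin_num => //.
  exact: integrable_cond_mean.
rewrite RintegralB// -EFin_expe -!EFinB/=.
by ring.
Qed.

Let integrable_unitM d' (Z : measurableType d') (nu : {measure set Z -> \bar R})
    (a g : Z -> R) : measurable_fun [set: Z] a ->
  (forall z, (0 <= a z <= 1)%R) -> nu.-integrable [set: Z] (EFin \o g) ->
  nu.-integrable [set: Z] (EFin \o (fun z => a z * g z)%R).
Proof.
move=> ma a01 ig; have mg : measurable_fun [set: Z] g.
  by apply/measurable_EFinP; case/integrableP : ig.
apply: le_integrable ig => //; first exact/measurable_EFinP/measurable_funM.
move=> z _ /=; have /andP[a0 a1] := a01 z.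
by rewrite lee_fin normrM ger0_norm// ler_piMl.
Qed.

Let rho01 x : (0 <= rho x <= 1)%R.
Proof. by rewrite rho_ge0 (holding_prob_le1 Arho1). Qed.

(** With [u = P f0] and [t = rho f0], the integrand [f (f - P' f)] of the lifted
    form equals [f ^ 2 - (u f + (rho f ^ 2 - t f))] almost everywhere.
    Integrating along the fibres replaces [f] by [f0] and [f ^ 2] by [m2],
    after which both sides are combinations of the same integrals over [X]. *)
Lemma dirichlet_lifted : (dirichlet J P' f =
  dirichlet pi P f0 + \int[pi]_x ((1 - rho x) * v x))%R.
Proof.
pose u x := kernel_op P f0 x.
have u2 : u \in Lfun pi 2%:E by exact: (Lfun2_kernel_op piP).
have mu : measurable_fun [set: X] u := ((Lfun2P _ _).1 u2).1.
pose t x := (rho x * f0 x)%R.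
have mt : measurable_fun [set: X] t by exact: measurable_funM.
have t2 : t \in Lfun pi 2%:E.
  apply/integrable_sqrP => //.
  apply: (eq_integrable measurableT
    (EFin \o (fun x => rho x ^+ 2 * f0 x ^+ 2)%R)).
    by move=> x _; rewrite /= /t exprMn.
  apply: integrable_unitM => //; first exact: measurable_funX.
  by move=> x; have /andP[? ?] := rho01 x; rewrite sqr_ge0 expr_le1.
have iJ w : w \in Lfun pi 2%:E ->
    J.-integrable [set: X * Y] (EFin \o (fun z => w z.1 * f z)%R).
  by move=> w2; apply/Lfun1_integrable/Lfun2_mul_Lfun1 => //; exact: Lfun2_fst.
have ipi w : w \in Lfun pi 2%:E ->
    pi.-integrable [set: X] (EFin \o (fun x => w x * f0 x)%R).
  by move=> w2; apply/Lfun1_integrable/Lfun2_mul_Lfun1.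
have iJm : J.-integrable [set: X * Y] (EFin \o (fun z => rho z.1 * f z ^+ 2)%R).
  by apply: integrable_unitM => //; exact: measurableT_comp.
have ipm : pi.-integrable [set: X] (EFin \o (fun x => rho x * m2 x)%R).
  exact: integrable_unitM.
have JuE := Rintegral_joint_lawM mu intf (iJ _ u2).
have JtE := Rintegral_joint_lawM mt intf (iJ _ t2).
have JmE := Rintegral_joint_lawM mrho intf2 iJm.
have J2E := Rintegral_cond_mean intf2.
have -> : dirichlet J P' f = (\int[pi]_x m2 x - (\int[pi]_x (u x * f0 x)
    + (\int[pi]_x (rho x * m2 x) - \int[pi]_x (t x * f0 x))))%R.
  rewrite -JuE -JtE -JmE -J2E -RintegralB//; last exact: iJ.
  rewrite -RintegralD//;
    [|exact: iJ|exact: (integrableB measurableT iJm (iJ _ t2))].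
  rewrite -RintegralB//; last first.
    exact: (integrableD measurableT (iJ _ u2)
      (integrableB measurableT iJm (iJ _ t2))).
  apply: ae_eq_Rintegral.
  - apply: measurable_funM => //; apply: measurable_funB => //.
    exact: measurable_kernel_op.
  - apply: measurable_funB; first exact: measurable_funX.
    apply: measurable_funD.
      by apply: measurable_funM => //; exact: measurableT_comp.
    apply: measurable_funB; apply: measurable_funM => //.
    + exact: measurableT_comp.
    + exact: measurable_funX.
    + exact: measurableT_comp.
  apply: filterS (kernel_op_lifted intf) => z Pfz.
  by rewrite /= Pfz /u /t; ring.
have -> : dirichlet pi P f0 =
    (\int[pi]_x f0 x ^+ 2 - \int[pi]_x (u x * f0 x))%R.
  rewrite -RintegralB//; last exact: ipi.
  by apply: eq_Rintegral => x _ /=; rewrite /u; ring.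
have -> : (\int[pi]_x ((1 - rho x) * v x) =
    (\int[pi]_x m2 x - \int[pi]_x f0 x ^+ 2) -
    (\int[pi]_x (rho x * m2 x) - \int[pi]_x (t x * f0 x)))%R.
  rewrite -RintegralB// -RintegralB//; last exact: ipi.
  rewrite -RintegralB//.
  - by apply: eq_Rintegral => x _; rewrite /t; ring.
  - exact: (integrableB measurableT intm2 intf0_2).
  - exact: (integrableB measurableT ipm (ipi _ t2)).
by ring.
Qed.

Lemma dirichlet_lifted_ge lam : (\forall x \ae pi, (rho x <= 1 - lam)%R) ->
  (lam * fine 'V_pi[f0] <= dirichlet pi P f0)%R ->
  (lam * fine 'V_J[f] <= dirichlet J P' f)%R.
Proof.
move=> rho_le gap; rewrite variance_lifted dirichlet_lifted mulrDr lerD//.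
have iv : pi.-integrable [set: X] (EFin \o v).
  exact: (integrableB measurableT intm2 intf0_2).
have irv : pi.-integrable [set: X] (EFin \o (fun x => (1 - rho x) * v x)%R).
  apply: integrable_unitM => //; first exact: measurable_funB.
  by move=> x; have /andP[? ?] := rho01 x; apply/andP; split; lra.
have mv : measurable_fun [set: X] v.
  by apply/measurable_EFinP; case/integrableP : iv.
rewrite -RintegralZl// -subr_ge0 -RintegralB//; last first.
  exact: (integrableZl measurableT lam iv).
apply: ae_ge0_Rintegral.
  apply: measurable_funB; last exact: measurable_funM.
  by apply: measurable_funM => //; exact: measurable_funB.
apply: filterS2 rho_le (sqr_cond_mean_le f2) => x rx vx.
by rewrite -mulrBl mulr_ge0 ?subr_ge0//; lra.
Qed.

End dirichlet_form.

(** This covers the functions whose fibre means are almost surely constant: the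
    Rayleigh quotient of [g] is then not part of the infimum that defines the
    gap, and gives no bound. *)
Lemma dirichlet_variance0 (g : X -> R) : g \in Lfun pi 2%:E -> 'V_pi[g] = 0 ->
  dirichlet pi P g = 0%R.
Proof.
move=> g2 V0; have mg := ((Lfun2P _ _).1 g2).1.
pose c := fine 'E_pi[g].
have gc : \forall x \ae pi, g x = c.
  have mgc : measurable_fun [set: X] (fun x => ((g x - c) ^+ 2)%:E).
    exact/measurable_EFinP/measurable_funX/measurable_funB.
  have := (ae_eq_integral_abs pi measurableT mgc).1.
  rewrite (_ : \int[pi]_x _ = 0); last first.
    rewrite -[RHS]V0 /variance covariance.unlock unlock.
    apply: eq_integral => x _.
    by rewrite gee0_abs ?lee_fin ?sqr_ge0// /c unlock.
  move=> /(_ erefl); apply: filterS => x /(_ I)[] /eqP.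
  by rewrite sqrf_eq0 subr_eq0 => /eqP.
have Pgc := kernel_op_ae_cst piP mg gc.
rewrite /dirichlet /inner_prod (@ae_eq_Rintegral _ _ _ pi _ (cst 0%R))//.
- by rewrite Rintegral_cst// mul0r.
- apply: measurable_funM => //; apply: measurable_funB => //.
  exact: measurable_kernel_op.
- by apply: filterS2 gc Pgc => x gx Pgx; rewrite /= gx Pgx subrr mulr0.
Qed.

(** The minimum [M] is an extended real: it is not [+oo] because
    [ess sup rho] is nonnegative, and the case [-oo] is trivial. *)
Lemma spectral_gap_lifted_ge :
  Order.min (spectral_gap pi P) (1 - ess_sup pi (EFin \o rho)) <=
  spectral_gap J P'.
Proof.
apply: le_ereal_inf_tmp => _ [f [f2 Vf] <-].
set M := Order.min _ _.
have Mgap : M <= spectral_gap pi P by rewrite ge_min lexx.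
have Mrho : M <= 1 - ess_sup pi (EFin \o rho) by rewrite ge_min lexx orbT.
have ess_ge0 : 0 <= ess_sup pi (EFin \o rho).
  apply: ess_sup_gee; first by rewrite [X in 0 < X]probability_setT.
  by apply: nearW => x; rewrite lee_fin.
have ess_ge := ess_sup_ge pi (EFin \o rho).
move: M Mgap Mrho => [lam| |] Mgap Mrho; last by rewrite leNye.
  have Vf_fin := variance_fin_num f2.
  have rho_le : \forall x \ae pi, (rho x <= 1 - lam)%R.
    apply: filterS ess_ge => x; move: ess_ge0 Mrho.
    case: (ess_sup _ _) => [e| |]//= _; rewrite !lee_fin; lra.
  rewrite lee_fin ler_pdivlMr; last first.
    by rewrite -lte_fin fineK.
  apply: dirichlet_lifted_ge => //.
  set g := cond_mean k f.
  have g2 : g \in Lfun pi 2%:E by exact: Lfun2_cond_mean.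
  have [Vg0|Vg0] := eqVneq 'V_pi[g] 0.
    by rewrite Vg0 mulr0 dirichlet_variance0.
  have Vg : 0 < 'V_pi[g] by rewrite lt_neqAle eq_sym Vg0 variance_ge0.
  rewrite -ler_pdivlMr; last by rewrite -lte_fin fineK// variance_fin_num.
  rewrite -lee_fin; apply: le_trans Mgap _.
  by apply: ereal_inf_lbound; exists g.
by move: ess_ge0 Mrho; case: (ess_sup _ _).
Qed.

End lower_bound.

End lifted_chain.

(** * The Metropolis--Hastings kernel *)

Section metropolis_hastings.
Context d (X : measurableType d) (R : realType).
Variables (pi : probability X R) (q : R.-pker X ~> X).
Variables (S : set (X * X)) (r : X -> X -> R).
Hypothesis hr : is_mh_ratio pi q S r.

(** On [S], [min(1, r) <= r] and [r] turns the proposal law into its reversal,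
    under which the second coordinate has law [pi]; off [S] nothing is
    accepted. *)
Lemma accepted_subinvariant B : measurable B ->
  \int[pi]_x accepted hr x B <= pi B.
Proof.
move=> mB; have mS := mh_set_measurable hr.
have msndB : measurable (@snd X X @^-1` B).
  by rewrite -[X in measurable X]setTI; exact: measurable_snd.
have mSB : measurable (S `&` snd @^-1` B) by exact: measurableI.
pose h (z : X * X) := (accept_prob r z.1 z.2 * \1_B z.2)%:E.
have h0 z : 0 <= h z by rewrite lee_fin mulr_ge0// (accept_prob_ge0 hr).
have mh : measurable_fun [set: X * X] h.
  apply/measurable_EFinP/measurable_funM.
    exact: measurable_accept_prob hr.
  exact: measurableT_comp.
have -> : \int[pi]_x accepted hr x B = \int[joint_law pi q]_z h z.
  rewrite ge0_integral_joint_law//; apply: eq_integral => x _.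
  rewrite [LHS]integral_mkcond; apply: eq_integral => y _.
  rewrite patchE /h/= indicE.
  by case: ifPn => _; rewrite ?mulr1 ?mulr0.
apply: (@le_trans _ _ (rev_joint_law pi q (S `&` snd @^-1` B))).
  rewrite (mh_ratio_density hr)//.
  rewrite [leRHS]integral_mkcond; apply: ge0_le_integral => //.
  - apply/(measurable_restrictT _ _).1 => //.
    apply: measurable_funTS; apply/measurable_EFinP.
    exact: mh_ratio_measurable hr.
  - move=> [x y] _; rewrite patchE /h/= indicE.
    have [yB|yB] := boolP (y \in B); last first.
      rewrite mulr0; case: ifPn => // _; rewrite lee_fin.
      exact: mh_ratio_ge0 hr _ _.
    rewrite mulr1; case: ifPn => [_|].
      by rewrite lee_fin /accept_prob ge_min lexx orbT.
    rewrite notin_setE => nSB; rewrite /accept_prob (mh_ratio_out hr).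
      by rewrite lee_fin ge_min lexx orbT.
    by move=> Sxy; apply: nSB; split => //; rewrite inE in yB.
have mswap A : measurable A ->
    measurable ((fun z : X * X => (z.2, z.1)) @^-1` A).
  move=> mA; rewrite -[X in measurable X]setTI.
  exact: (measurable_swap _ mA).
apply: (@le_trans _ _ (joint_law pi q (fst @^-1` B))); last first.
  by rewrite joint_law_fst.
apply: (@le_measure _ _ _ (joint_law pi q)); rewrite ?inE.
- exact: mswap.
- by rewrite -[X in measurable X]setTI; exact: measurable_fst.
- by move=> z [].
Qed.

(** The accepted moves and the rejected ones each contribute at most [pi B]. *)
Lemma marginal_quasi_invariant B : measurable B ->
  \int[pi]_x marginal_kernel hr x B <= 2%:E * pi B.
Proof.
move=> mB; under eq_integral do rewrite holding_kernelE.
have mrho := measurable_holding_prob (rejectionE hr).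
rewrite ge0_integralD//; last 3 first.
- exact: (measurable_kernel (accepted hr) _ mB).
- by move=> x _; rewrite mule_ge0// lee_fin (rejection_ge0 hr).
- apply: emeasurable_funM; first exact/measurable_EFinP.
  exact/measurable_EFinP/measurable_indic.
rewrite (_ : 2%:E = 1 + 1)// ge0_muleDl// !mul1e leeD ?accepted_subinvariant//.
apply: (@le_trans _ _ (\int[pi]_x (\1_B x)%:E)); last first.
  by rewrite integral_indic// setIT.
apply: ge0_le_integral => //.
- by move=> x _; rewrite mule_ge0// lee_fin (rejection_ge0 hr).
- apply: emeasurable_funM; first exact/measurable_EFinP.
  exact/measurable_EFinP/measurable_indic.
- exact/measurable_EFinP/measurable_indic.
- move=> x _; rewrite diracE -EFinM lee_fin.
  by rewrite ler_piMl// (holding_prob_le1 (rejectionE hr)).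
Qed.

End metropolis_hastings.

Theorem proposition8 (R : realType) (d : measure_display)
    (X : measurableType d) (pi : probability X R) (q : R.-pker X ~> X)
    (S : set (X * X)) (r : X -> X -> R) (hr : is_mh_ratio pi q S r)
    (W : borel_weights R) (Q : R.-pker X ~> weight W)
    (hQ : forall x : X, \int[Q x]_w (weight_val w)%:E = 1) :
  Order.min (spectral_gap pi (marginal_kernel hr))
      (1 - ess_sup pi (EFin \o rejection q r))
    <= spectral_gap (aux_target pi hQ) (auxiliary_kernel hr hQ)
  /\ spectral_gap (aux_target pi hQ) (auxiliary_kernel hr hQ)
    <= spectral_gap pi (marginal_kernel hr).
Proof.
split; last by apply: spectral_gap_lifted_le => z U _.
apply: (spectral_gap_lifted_ge _ _ _ (C := 2%:nng%R)) => [z U _|B mB] //.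
exact: marginal_quasi_invariant.
Qed.
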